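(* (a) If $p_k>1$ for all $k$, then $[l(r,s,t,p;B)]^\alpha=H_5(p)$; and if $0<p_k\le1$ for all $k$, then $[l(r,s,t,p;B)]^\alpha=H_4(p)$. (b) For $0<p_k\le H<\infty$: (i) $[c_0(r,s,t,p;B)]^\alpha=H_1(p)$; (ii) $[c(r,s,t,p;B)]^\alpha=H_1(p)\cap H_2(p)$; (iii) $[l_\infty(r,s,t,p;B)]^\alpha=H_3(p)$. Here, with $$c_{nk}(a)=\sum_{j=k}^{n}(-1)^{j-k}\frac{(-v)^{n-j}}{u^{n-j+1}}\frac{D^{(s)}_{j-k}}{t_j}r_k\,a_n\quad(0\le k\le n),\qquad c_{nk}(a)=0\quad(k>n),$$ the sets are $$H_1(p)=\bigcup_{L\in\mathbb{N}}\Big\{a\in w:\sup_F\sum_n\Big|\sum_{k\in F}c_{nk}(a)L^{-1/p_k}\Big|<\infty\Big\},\quad H_2(p)=\Big\{a\in w:\sum_n\Big|\sum_kc_{nk}(a)\Big|<\infty\Big\},$$ $$H_3(p)=\bigcap_{L\in\mathbb{N}}\Big\{a\in w:\sup_F\sum_n\Big|\sum_{k\in F}c_{nk}(a)L^{1/p_k}\Big|<\infty\Big\},\quad H_4(p)=\Big\{a\in w:\sup_F\sup_k\Big|\sum_{n\in F}c_{nk}(a)\Big|^{p_k}<\infty\Big\},$$ $$H_5(p)=\bigcup_{L\in\mathbb{N}}\Big\{a\in w:\sup_F\sum_k\Big|\sum_{n\in F}c_{nk}(a)L^{-1}\Big|^{p_k'}<\infty\Big\},$$ where $F$ ranges over the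 nonempty finite subsets of $\mathbb{N}_0$ and $p_k'=p_k/(p_k-1)$ (used when $p_k>1$).
   Context: Sequences are indexed by $\mathbb{N}_0=\{0,1,2,\dots\}$; $\mathbb{N}=\{1,2,\dots\}$; $w$ is the space of all real or complex sequences. $p=(p_k)$ is a bounded sequence of strictly positive real numbers, $H=\sup_k p_k$. The spaces of Maddox are $l_\infty(p)=\{x\in w:\sup_k|x_k|^{p_k}<\infty\}$, $c(p)=\{x\in w:\lim_k|x_k-l|^{p_k}=0\text{ for some }l\in\mathbb{C}\}$, $c_0(p)=\{x\in w:\lim_k|x_k|^{p_k}=0\}$, $l(p)=\{x\in w:\sum_k|x_k|^{p_k}<\infty\}$. $r=(r_n)$, $t=(t_n)$, $s=(s_n)$ are sequences in $w$ with $r_n\ne0$ and $t_n\neq 0$ for all $n$, and $s_0\neq0$; $u,v$ are nonzero scalars. $A(r,s,t)$ is the lower triangular infinite matrix with entries $s_{n-k}t_k/r_n$ for $0\le k\le n$ and $0$ for $k>n$. $B=B(u,v)=(b_{nk})$ is the matrix with $b_{nn}=u$, $b_{n,n-1}=v$ and all other entries $0$. $A(r,s,t;B)=A(r,s,t)\cdot B$ is the matrix product. For $X\in\{l_\infty(p),c(p),c_0(p),l(p)\}$, $X(r,s,t,p;B)=\{x\in w:A(r,s,t;B)x\in X\}$, written $l_\infty(r,s,t,p;B)$, $c(r,s,t,p;B)$, $c_0(r,s,t,p;B)$, $l(r,s,t,p;B)$ respectively. $D^{(s)}_0=1/s_0$ and, for $n\ge1$, $D^{(s)}_n=s_0^{-(n+1)}\det(d_{ij})_{1\le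 i,j\le n}$ with $d_{ij}=s_{i-j+1}$ if $j\le i+1$ and $d_{ij}=0$ if $j>i+1$. The $\alpha$-dual of $U\subset w$ is $U^\alpha=\{a\in w:(a_nx_n)_n\in l_1\text{ for all }x\in U\}$. *)

(* Defs.v *)
From HB Require Import structures.
From mathcomp Require Import all_boot all_order all_algebra.
From mathcomp Require Import all_classical all_reals all_analysis.
From mathcomp Require Import finmap.
From mathcomp Require Import complex.

Set Implicit Arguments.
Unset Strict Implicit.
Unset Printing Implicit Defensive.

Import Order.TTheory GRing.Theory Num.Theory.
Import numFieldNormedType.Exports.

Local Open Scope classical_set_scope.
Local Open Scope ring_scope.

(* The space w consists of all real, or of all complex, sequences: the scalar
   field is either R or R[i]. *)
Inductive scalar_kind := RealScalars | ComplexScalars.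

Section Scalars.
Variable R : realType.

Definition scalars (b : scalar_kind) : numFieldType :=
  match b with
  | RealScalars => R
  | ComplexScalars => complex R
  end.

(* The norm `|z| of z : R[i] lives in R[i]; the modulus takes values in R. *)
Definition modulus (b : scalar_kind) : scalars b -> R :=
  match b return scalars b -> R with
  | RealScalars => fun x => `|x|
  | ComplexScalars => fun z => ComplexField.Normc.normc z
  end.

Definition of_real (b : scalar_kind) : R -> scalars b :=
  match b return R -> scalars b with
  | RealScalars => fun x => x
  | ComplexScalars => fun x => real_complex R x
  end.

End Scalars.

Arguments modulus {R b} _.
Arguments of_real {R} b _.

Section MaddoxSpaces.
Variables (R : realType) (b : scalar_kind).
Local Notation K := (scalars R b).
Implicit Types (p : nat -> R) (x : nat -> K).

Definition maddox_linfty p : set (nat -> K) :=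
  [set x | (ereal_sup (range (fun k => (modulus (x k) `^ p k)%:E)) < +oo)%E].

Definition maddox_c p : set (nat -> K) :=
  [set x | exists l : K, (fun k => modulus (x k - l) `^ p k) @ \oo --> (0 : R)].

Definition maddox_c0 p : set (nat -> K) :=
  [set x | (fun k => modulus (x k) `^ p k) @ \oo --> (0 : R)].

Definition maddox_l p : set (nat -> K) :=
  [set x | (\sum_(0 <= k <oo) (modulus (x k) `^ p k)%:E < +oo)%E].

Definition ell1 : set (nat -> K) :=
  [set x | (\sum_(0 <= k <oo) (modulus (x k))%:E < +oo)%E].

Definition alpha_dual (U : set (nat -> K)) : set (nat -> K) :=
  [set a | forall x, U x -> ell1 (fun n => a n * x n)].

End MaddoxSpaces.

Section Matrices.
Variable K : fieldType.

(* Infinite matrices. All those considered here are lower triangular, so that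
   the series over j (resp. k) in a product (resp. transform) stops at n. *)
Definition lt_mul (A C : nat -> nat -> K) (n k : nat) : K :=
  \sum_(0 <= j < n.+1) A n j * C j k.

Definition lt_transform (A : nat -> nat -> K) (x : nat -> K) (n : nat) : K :=
  \sum_(0 <= k < n.+1) A n k * x k.

Definition A_rst (r s t : nat -> K) (n k : nat) : K :=
  if (k <= n)%N then s (n - k)%N * t k / r n else 0.

Definition B_uv (u v : K) (n k : nat) : K :=
  if k == n then u else if k.+1 == n then v else 0.

Definition A_rstB (r s t : nat -> K) (u v : K) : nat -> nat -> K :=
  lt_mul (A_rst r s t) (B_uv u v).

(* X(r,s,t,p;B), for X a set of sequences *)
Definition rstB_space (X : set (nat -> K)) (r s t : nat -> K) (u v : K) :
    set (nat -> K) :=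
  [set x | X (lt_transform (A_rstB r s t u v) x)].

(* The indices i, j start at 0 instead of 1, which changes neither i - j nor
   the condition j <= i + 1. *)
Definition D_coef (s : nat -> K) (n : nat) : K :=
  if n == 0%N then (s 0%N)^-1
  else (s 0%N) ^- n.+1 *
       \det (\matrix_(i < n, j < n) (if (j <= i.+1)%N then s (i.+1 - j)%N else 0)).

Definition c_coef (r s t : nat -> K) (u v : K) (a : nat -> K) (n k : nat) : K :=
  if (k <= n)%N then
    \sum_(k <= j < n.+1)
      (-1) ^+ (j - k) * ((- v) ^+ (n - j) / u ^+ (n - j).+1) *
      (D_coef s (j - k) / t j) * r k * a n
  else 0.

End Matrices.

Section DualSets.
Variables (R : realType) (b : scalar_kind).
Local Notation K := (scalars R b).
Variables (r s t : nat -> K) (u v : K) (p : nat -> R).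
Local Notation c := (c_coef r s t u v).

Definition finite_index_sets : set {fset nat} :=
  [set F | F != fset0].

Definition H1 : set (nat -> K) :=
  \bigcup_(L in [set L : nat | (0 < L)%N])
    [set a | (ereal_sup
      [set \sum_(0 <= n <oo) (modulus
             (\sum_(k <- F) c a n k * of_real b (L%:R `^ (- (p k)^-1))))%:E
        | F in finite_index_sets] < +oo)%E].

(* c a n k = 0 for k > n, so the inner series over k is a finite sum. *)
Definition H2 : set (nat -> K) :=
  [set a | (\sum_(0 <= n <oo)
      (modulus (\sum_(0 <= k < n.+1) c a n k)%R)%:E < +oo)%E].

Definition H3 : set (nat -> K) :=
  \bigcap_(L in [set L : nat | (0 < L)%N])
    [set a | (ereal_sup
      [set \sum_(0 <= n <oo) (modulus
             (\sum_(k <- F) c a n k * of_real b (L%:R `^ (p k)^-1)))%:E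
        | F in finite_index_sets] < +oo)%E].

Definition H4 : set (nat -> K) :=
  [set a | (ereal_sup
      [set ereal_sup (range (fun k =>
             (modulus (\sum_(n <- F) c a n k)%R `^ p k)%:E))
        | F in finite_index_sets] < +oo)%E].

Definition H5 : set (nat -> K) :=
  \bigcup_(L in [set L : nat | (0 < L)%N])
    [set a | (ereal_sup
      [set \sum_(0 <= k <oo)
             (modulus (\sum_(n <- F) c a n k * L%:R^-1)%R
                `^ (p k / (p k - 1)))%:E
        | F in finite_index_sets] < +oo)%E].

End DualSets.

(* Main.v *)
Require Import Defs.
From HB Require Import structures.
From mathcomp Require Import all_boot all_order all_algebra.
From mathcomp Require Import all_classical all_reals all_analysis.
From mathcomp Require Import finmap complex ring lra zify.
Import Order.TTheory GRing.Theory Num.Theory.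
Import numFieldNormedType.Exports.
Local Open Scope classical_set_scope.
Local Open Scope ring_scope.
Set Implicit Arguments.
Unset Strict Implicit.
Unset Printing Implicit Defensive.

(** Write T for the triangle A(r,s,t;B). Its diagonal entries do not vanish,
so y = T x is a bijection of the space of all sequences onto itself, and x
lies in X(r,s,t,p;B) exactly when y lies in X. The inverse of T is explicit:
B is inverted by a geometric progression, and A(r,s,t) is a Toeplitz triangle
framed by two diagonal matrices, hence is inverted through the reciprocal
power series of s, whose n-th coefficient is (-1)^n D_n (Cramer's rule,
[conv_alt_D]). Substituting x = T^-1 y turns a_n x_n into the n-th coordinate
of C y, where C is the triangle c(a). So a belongs to the alpha-dual iff C
maps X into l_1 ([alpha_dualP]), and the theorem becomes a description of the
lower triangular matrices mapping each Maddox space into l_1.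

Both directions of that description work with the partial norms
q_N(y) = sum of |(C y)_n| over n < N.

Sufficiency. The largest value of a seminorm on a polydisc is, up to a factor
4, attained at a 0-1 sequence: split into real and imaginary, then positive
and negative parts, and use convexity on the cube ([seminorm_polydisc]).
Applied to q_N with weights, this bounds q_N(y) by the row sums over finite
sets F of columns (H_1, H_3). Applied to w |-> |sum_n z_n w_n|, it bounds a
sum of moduli by the sums over finite sets F of rows ([sum_modulus_le]), after
which l(p) is handled by Young's inequality (p_k > 1, H_5) or by
x <= x^p_k for small x (p_k <= 1, H_4).

Necessity. A uniform boundedness principle gives a constant B and a small set
P of sequences on which all q_N are at most B ([gliding_hump]); testing on
well chosen members of P yields the conditions. As C is lower triangular, a
gliding hump argument is enough: if q_N were unbounded on each of the sets
P_j, sequences from P_0, P_1, P_2, and so on could be placed on consecutive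
blocks of indices, each block chosen beyond all the rows which served to make
the preceding ones large. The sequence so obtained lies in X but its
transform is not in l_1.

The space c(p) is c_0(p) plus the constants, whence the condition H_2. *)

(** * Inverting the triangle A(r,s,t;B) *)

Lemma sum_nat_widen (V : nmodType) (f : nat -> V) m N : (m <= N)%N ->
    (forall k, (m <= k)%N -> f k = 0) ->
  \sum_(0 <= k < N) f k = \sum_(0 <= k < m) f k.
Proof.
move=> mN f0; rewrite (big_cat_nat (n := m)) //=.
rewrite [X in _ + X]big1_seq ?addr0// => k.
by rewrite mem_index_iota => /andP[_ /andP[/f0]].
Qed.

Section InverseMatrices.
Variable K : fieldType.
Implicit Types (M A : nat -> nat -> K) (x y e s : nat -> K).

Definition lower_triangular M := forall n k, (n < k)%N -> M n k = 0.

Definition trunc_mx M N : 'M[K]_N := \matrix_(i < N, j < N) M i j.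

Lemma sum_ord_widen (f : nat -> K) m N : (m <= N)%N ->
    (forall k, (m <= k)%N -> f k = 0) ->
  \sum_(k < N) f k = \sum_(0 <= k < m) f k.
Proof. by move=> mN f0; rewrite -(big_mkord predT f); exact: sum_nat_widen. Qed.

(** Lower triangularity makes truncation to the first N indices
multiplicative, so identities between infinite triangles can be read off
square matrices, where a right inverse is also a left inverse. *)
Lemma trunc_mxM M A N : lower_triangular M ->
  trunc_mx M N *m trunc_mx A N = trunc_mx (lt_mul M A) N.
Proof.
move=> Mlow; apply/matrixP => i j; rewrite !mxE.
under eq_bigr do rewrite !mxE.
rewrite (@sum_ord_widen (fun l => M i l * A l j) i.+1)// => k ik.
by rewrite Mlow ?mul0r.
Qed.

Lemma trunc_mx_transform M N x : lower_triangular M ->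
  trunc_mx M N *m (\col_(i < N) x i) = \col_(i < N) lt_transform M x i.
Proof.
move=> Mlow; apply/colP => i; rewrite !mxE.
under eq_bigr do rewrite !mxE.
rewrite (@sum_ord_widen (fun l => M i l * x l) i.+1)// => k ik.
by rewrite Mlow ?mul0r.
Qed.

Definition toeplitz s n k : K := if (k <= n)%N then s (n - k)%N else 0.

Lemma toeplitz_low s : lower_triangular (toeplitz s).
Proof. by move=> n k nk; rewrite /toeplitz leqNgt nk. Qed.

Lemma det_toeplitz s N : \det (trunc_mx (toeplitz s) N) = s 0%N ^+ N.
Proof.
rewrite det_trig; last first.
  by apply/is_trig_mxP => i j ij; rewrite mxE toeplitz_low.
rewrite (eq_bigr (fun=> s 0%N)) => [|i _].
  by rewrite prodr_const card_ord.
by rewrite !mxE /toeplitz leqnn subnn.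
Qed.

(** The coefficients of the power series 1/s, as [conv_alt_D] shows. *)
Definition alt_D s n : K := (-1) ^+ n * D_coef s n.

(** Cramer's rule for the last entry of the first column: deleting row 0 and
the last column of the Toeplitz triangle leaves the matrix of [D_coef]. *)
Lemma invmx_toeplitz s n : s 0%N != 0 ->
  invmx (trunc_mx (toeplitz s) n.+1) ord_max ord0 = alt_D s n.
Proof.
move=> s0; have ds := det_toeplitz s n.+1.
have un : trunc_mx (toeplitz s) n.+1 \in unitmx.
  by rewrite unitmxE ds unitfE expf_neq0.
rewrite /invmx un !mxE ds /cofactor /= add0n /alt_D /D_coef mulrCA.
congr (_ * _); case: n ds un => [|n] ds un /=.
  by rewrite det_mx00 mulr1 expr1.
congr (_ * \det _); apply/matrixP => i j.
have nj : (n < j)%N = false by rewrite ltnNge -ltnS ltn_ord.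
by rewrite !mxE /toeplitz /= /bump leq0n nj.
Qed.

(** The triangular system for 1/s can be solved step by step since s_0 is
invertible; this solution serves to compare the determinants of different
sizes in [conv_alt_D]. *)
Lemma conv_inverse_ex s n : s 0%N != 0 -> exists e, forall i, (i < n)%N ->
  lt_transform (toeplitz s) e i = (i == 0%N)%:R.
Proof.
move=> s0; elim: n => [|n [e eP]]; first by exists (fun=> 0).
pose c := ((n == 0%N)%:R - \sum_(0 <= k < n) toeplitz s n k * e k) / s 0%N.
exists (fun i => if i == n then c else e i) => i; rewrite ltnS leq_eqVlt.
case/predU1P => [->|lt_in].
  rewrite /lt_transform big_nat_recr //= eqxx /toeplitz leqnn subnn.
  rewrite [s 0%N * c]mulrC divfK// addrC.
  rewrite [X in _ + X](eq_big_nat _ _ (F2 := fun k => toeplitz s n k * e k)).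
    by rewrite subrK.
  by move=> k /andP[_ kn]; rewrite (ltn_eqF kn).
rewrite -eP// /lt_transform; apply: eq_big_nat => k /andP[_ ki].
by rewrite (_ : k == n = false)//; apply/ltn_eqF/(leq_trans ki).
Qed.

(** The solution of the triangular system of size k + 1 is unique, hence is
the first column of the inverse matrix, whose last entry is [alt_D s k]. The
solution does not depend on the size, so these last entries, taken over all
k, form one solution. *)
Lemma conv_alt_D s n : s 0%N != 0 ->
  lt_transform (toeplitz s) (alt_D s) n = (n == 0%N)%:R.
Proof.
move=> s0; have [e eP] := conv_inverse_ex n.+1 s0.
rewrite -eP// /lt_transform; apply: eq_big_nat => k /andP[_ kn]; congr (_ * _).
rewrite -(invmx_toeplitz _ s0).
have un : trunc_mx (toeplitz s) k.+1 \in unitmx.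
  by rewrite unitmxE det_toeplitz unitfE expf_neq0.
have : trunc_mx (toeplitz s) k.+1 *m (\col_(i < k.+1) e i) =
       delta_mx ord0 ord0.
  rewrite trunc_mx_transform; last exact: toeplitz_low.
  apply/colP => i; rewrite !mxE eqxx andbT eP //.
  by rewrite (leq_trans (ltn_ord i)).
move/(congr1 (mulmx (invmx (trunc_mx (toeplitz s) k.+1)))).
rewrite mulKmx// => /colP/(_ ord_max); rewrite !mxE /= => ->.
by rewrite (bigD1 ord0)//= mxE eqxx mulr1 big1 ?addr0// => i i0;
   rewrite mxE (negbTE i0) mulr0.
Qed.

Section Triangle.
Variables (r s t : nat -> K) (u v : K).
Hypotheses (r0 : forall n, r n != 0) (t0 : forall n, t n != 0).
Hypotheses (s0 : s 0%N != 0) (u0 : u != 0).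

Definition A_rst_inv n k : K :=
  if (k <= n)%N then alt_D s (n - k) / t n * r k else 0.

Definition B_uv_inv n k : K :=
  if (k <= n)%N then (- v) ^+ (n - k) / u ^+ (n - k).+1 else 0.

Definition rstB_inv := lt_mul B_uv_inv A_rst_inv.

Lemma A_rst_low : lower_triangular (A_rst r s t).
Proof. by move=> n k nk; rewrite /A_rst leqNgt nk. Qed.
Lemma A_rst_inv_low : lower_triangular A_rst_inv.
Proof. by move=> n k nk; rewrite /A_rst_inv leqNgt nk. Qed.
Lemma B_uv_inv_low : lower_triangular B_uv_inv.
Proof. by move=> n k nk; rewrite /B_uv_inv leqNgt nk. Qed.
Lemma B_uv_low : lower_triangular (B_uv u v).
Proof. by move=> n k nk; rewrite /B_uv (gtn_eqF nk) gtn_eqF// ltnW. Qed.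

Lemma lt_mul_low M A : lower_triangular A -> lower_triangular (lt_mul M A).
Proof.
move=> Al n k nk; rewrite /lt_mul big1_seq// => j.
rewrite mem_index_iota => /andP[_ /andP[_ jn]].
by rewrite Al ?mulr0// (leq_trans jn).
Qed.

(** Up to the diagonal factors this is the convolution of s and 1/s, shifted
to start at k. *)
Lemma A_rst_invE n k : lt_mul (A_rst r s t) A_rst_inv n k = (n == k)%:R.
Proof.
have [nk|kn] := ltnP n k.
  by rewrite (lt_mul_low _ A_rst_inv_low)// (ltn_eqF nk).
rewrite /lt_mul (big_cat_nat (n := k)) ?leqW//=.
rewrite big1_seq ?add0r; last first.
  move=> j; rewrite mem_index_iota => /andP[_ /andP[_ jk]].
  by rewrite A_rst_inv_low ?mulr0.
rewrite -{1}[k]add0n big_addn subSn//.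
rewrite (eq_big_nat _ _ (F2 := fun j =>
   r k / r n * (toeplitz s (n - k) j * alt_D s j))).
  rewrite -big_distrr /= -/(lt_transform _ _ _) conv_alt_D//.
  rewrite subn_eq0 [in RHS]eqn_leq kn andbT.
  have [nk|_] := leqP n k; last by rewrite mulr0.
  by rewrite (@anti_leq n k) ?nk ?kn// mulr1 divff.
move=> j /andP[_]; rewrite ltnS => jnk.
rewrite /A_rst /A_rst_inv /toeplitz leq_addl addnK jnk.
rewrite (_ : (j + k <= n)%N); last lia.
rewrite (_ : (n - (j + k) = n - k - j)%N); last lia.
by field; rewrite r0 t0.
Qed.

(** Only the indices n - 1 and n contribute, and the geometric progression
cancels. *)
Lemma B_uv_invE n k : lt_mul (B_uv u v) B_uv_inv n k = (n == k)%:R.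
Proof.
rewrite /lt_mul big_nat_recr//= {2}/B_uv eqxx.
case: n => [|n].
  rewrite big_nil add0r /B_uv_inv leqn0 eq_sym.
  by case: k => //= ; rewrite ?mulr0// subnn expr0 expr1 mul1r divff.
rewrite big_nat_recr//= {2}/B_uv eqxx (ltn_eqF (ltnSn n)).
rewrite big1_seq ?add0r => [|j]; last first.
  rewrite mem_index_iota => /andP[_ jn]; rewrite /B_uv.
  by rewrite eqSS (ltn_eqF jn) (ltn_eqF (ltn_trans jn (ltnSn n))) mul0r.
rewrite /B_uv_inv; have [nk|kn] := leqP k n.
  rewrite leqW// subSn// gtn_eqF// !exprS.
  have := expf_neq0 (n - k) u0; move: (_ ^+ _) ((- v) ^+ _) => z w z0.
  by rewrite mulr0n; field; rewrite z0 u0.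
rewrite mulr0 add0r; have [kn1|] := leqP k n.+1.
  have -> : k = n.+1 by lia.
  by rewrite subnn eqxx expr0 expr1 mul1r divff.
by move=> nk; rewrite mulr0 ltn_eqF.
Qed.

Local Notation T := (A_rstB r s t u v).

Lemma rstB_low : lower_triangular T.
Proof. exact/lt_mul_low/B_uv_low. Qed.

Lemma rstB_inv_low : lower_triangular rstB_inv.
Proof. exact/lt_mul_low/A_rst_inv_low. Qed.

Lemma trunc_TG N : trunc_mx T N *m trunc_mx rstB_inv N = 1%:M.
Proof.
rewrite -!trunc_mxM; [|exact: B_uv_inv_low|exact: A_rst_low].
rewrite -mulmxA [X in _ *m X]mulmxA trunc_mxM; last exact: B_uv_low.
rewrite (_ : trunc_mx (lt_mul _ B_uv_inv) N = 1%:M) ?mul1mx; last first.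
  by apply/matrixP => i j; rewrite !mxE B_uv_invE.
rewrite trunc_mxM; last exact: A_rst_low.
by apply/matrixP => i j; rewrite !mxE A_rst_invE.
Qed.

Lemma rstB_invK y : lt_transform T (lt_transform rstB_inv y) = y.
Proof.
apply/funext => n.
have /(congr1 (mulmx^~ (\col_(i < n.+1) y i))) := trunc_TG n.+1.
rewrite -mulmxA mul1mx !trunc_mx_transform;
  [|exact: rstB_low|exact: rstB_inv_low].
by move/colP/(_ ord_max); rewrite !mxE.
Qed.

(** The order of the factors can be exchanged in the finite truncations. *)
Lemma rstBK x : lt_transform rstB_inv (lt_transform T x) = x.
Proof.
apply/funext => n.
have /mulmx1C/(congr1 (mulmx^~ (\col_(i < n.+1) x i))) := trunc_TG n.+1.
rewrite -mulmxA mul1mx !trunc_mx_transform;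
  [|exact: rstB_inv_low|exact: rstB_low].
by move/colP/(_ ord_max); rewrite !mxE.
Qed.

Lemma c_coefE a n k : c_coef r s t u v a n k = a n * rstB_inv n k.
Proof.
rewrite /c_coef; have [kn|nk] := leqP k n; last by rewrite rstB_inv_low ?mulr0.
rewrite /rstB_inv /lt_mul [in RHS](big_cat_nat (n := k)) ?leqW//=.
rewrite [X in _ = _ * (X + _)]big1_seq ?add0r; last first.
  move=> j; rewrite mem_index_iota => /andP[_ /andP[_ jk]].
  by rewrite A_rst_inv_low ?mulr0.
rewrite big_distrr; apply: eq_big_nat => j /andP[kj]; rewrite ltnS => jn /=.
by rewrite /B_uv_inv /A_rst_inv jn kj /alt_D; ring.
Qed.

Lemma c_coef_low a : lower_triangular (c_coef r s t u v a).
Proof. by move=> n k nk; rewrite /c_coef leqNgt nk. Qed.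

Lemma lt_transform_c_coef a y n :
  lt_transform (c_coef r s t u v a) y n = a n * lt_transform rstB_inv y n.
Proof.
by rewrite /lt_transform big_distrr; apply: eq_bigr => k _ /=;
   rewrite c_coefE mulrA.
Qed.

End Triangle.
End InverseMatrices.

(** * The modulus of real or complex scalars *)

Section RealImaginary.
Variables (R : realType) (b : scalar_kind).

Definition re_part : scalars R b -> R :=
  match b return scalars R b -> R with
  | RealScalars => fun w => w
  | ComplexScalars => fun w => complex.Re w
  end.

Definition im_part : scalars R b -> R :=
  match b return scalars R b -> R with
  | RealScalars => fun=> 0
  | ComplexScalars => fun w => complex.Im w
  end.

(** A real scalar has no imaginary part, so there any value of modulus at most 1
satisfies [re_im_decomp] and [modulus_imag_unit]. *)
Definition imag_unit : scalars R b :=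
  match b return scalars R b with
  | RealScalars => 0
  | ComplexScalars => 'i%C
  end.

End RealImaginary.

Arguments re_part {R b} _.
Arguments im_part {R b} _.

Section Modulus.
Variables (R : realType) (b : scalar_kind).
Local Notation K := (scalars R b).
Implicit Types (x y z : K) (a c : R).

Lemma modulusM x y : modulus (x * y) = modulus x * modulus y.
Proof.
by case: b x y => x y /=; [exact: normrM|exact: ComplexField.Normc.normcM].
Qed.

Lemma modulusD x y : modulus (x + y) <= modulus x + modulus y.
Proof. by case: b x y => x y /=; [exact: ler_normD|exact: le_normcD]. Qed.

Lemma modulus0 : modulus (0 : K) = 0.
Proof. by case: b => /=; [exact: normr0|exact: ComplexField.Normc.normc0]. Qed.

Lemma modulus1 : modulus (1 : K) = 1.
Proof. by case: b => /=; [exact: normr1|exact: ComplexField.Normc.normc1]. Qed.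

Lemma modulus_ge0 x : 0 <= modulus x.
Proof. by case: b x => //= -[p q]; rewrite sqrtr_ge0. Qed.

Lemma modulus_of_real a : modulus (of_real b a) = `|a|.
Proof. by case: b => //=; rewrite expr0n addr0 sqrtr_sqr. Qed.

Lemma of_realM a c : of_real b (a * c) = of_real b a * of_real b c.
Proof. by case: b => //=; exact: rmorphM. Qed.

Lemma of_realD a c : of_real b (a + c) = of_real b a + of_real b c.
Proof. by case: b => //=; exact: rmorphD. Qed.

Lemma of_real0 : of_real b (0 : R) = 0.
Proof. by case: b. Qed.

Lemma of_real1 : of_real b (1 : R) = 1.
Proof. by case: b. Qed.

Lemma of_realN1 : of_real b (- 1 : R) = - 1.
Proof. by case: b => //=; exact: rmorphN1. Qed.

Lemma of_real_sum (I : Type) (s : seq I) (P : pred I) (f : I -> R) :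
  of_real b (\sum_(i <- s | P i) f i) = \sum_(i <- s | P i) of_real b (f i).
Proof. exact: (big_morph _ of_realD of_real0). Qed.

Lemma modulus_sum (I : Type) (s : seq I) (P : pred I) (f : I -> K) :
  modulus (\sum_(i <- s | P i) f i) <= \sum_(i <- s | P i) modulus (f i).
Proof.
elim/big_rec2: _ => [|i y x _ h]; first by rewrite modulus0.
by rewrite (le_trans (modulusD _ _))// lerD2l.
Qed.

Lemma re_im_decomp z :
  z = of_real b (re_part z) + imag_unit R b * of_real b (im_part z).
Proof.
case: b z => /= [z|[p q]]; first by rewrite mul0r addr0.
by rewrite /real_complex_def; simpc.
Qed.

Lemma modulus_imag_unit : modulus (imag_unit R b) <= 1.
Proof.
by case: b => /=; rewrite ?normr0// expr0n expr1n add0r sqrtr1.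
Qed.

Lemma re_part_le z : `|re_part z| <= modulus z.
Proof.
case: b z => //= -[p q] /=.
by rewrite -sqrtr_sqr ler_wsqrtr// lerDl sqr_ge0.
Qed.

Lemma im_part_le z : `|im_part z| <= modulus z.
Proof.
case: b z => /= [z|[p q] /=]; first by rewrite normr0.
by rewrite -sqrtr_sqr ler_wsqrtr// lerDr sqr_ge0.
Qed.

Lemma modulus_eq0 z : modulus z = 0 -> z = 0.
Proof.
by case: b z => z /=; [move/eqP; rewrite normr_eq0 => /eqP|
  exact: ComplexField.Normc.eq0_normc].
Qed.

Lemma modulusV z : modulus z^-1 = (modulus z)^-1.
Proof.
by case: b z => z /=; [exact: normfV|exact: ComplexField.Normc.normcV].
Qed.

(** The unimodular number that rotates z onto its modulus. *)
Definition phase z : K :=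
  if z == 0 then 1 else of_real b (modulus z) / z.

Lemma modulus_phase z : modulus (phase z) = 1.
Proof.
rewrite /phase; case: eqP => [_|z0]; first exact: modulus1.
rewrite modulusM modulusV modulus_of_real ger0_norm ?modulus_ge0//.
by rewrite divff//; apply/eqP => /modulus_eq0.
Qed.

Lemma mul_phase z : z * phase z = of_real b (modulus z).
Proof.
rewrite /phase; case: eqP => [->|/eqP z0].
  by rewrite mul0r modulus0 of_real0.
by rewrite mulrC divfK.
Qed.

(** * Seminorms on polydiscs *)

Section Seminorm.
Variables (g : (nat -> K) -> R) (M : R) (m : nat).
Hypothesis gD : forall x y : nat -> K, g (fun k => x k + y k) <= g x + g y.
Hypothesis gZ : forall d (x : nat -> K), g (fun k => d * x k) = modulus d * g x.
Hypothesis gm : forall x y : nat -> K,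
  (forall k, (k < m)%N -> x k = y k) -> g x = g y.
Hypothesis gF : forall F : pred nat, g (fun k => (F k)%:R) <= M.

Lemma seminorm_ge0 : 0 <= M.
Proof.
have := gF pred0; rewrite [X in g X](_ : _ = fun k => 0 * 0); last first.
  by apply/funext => k; rewrite mul0r.
by rewrite gZ modulus0 mul0r.
Qed.

(** A sequence of [0,1]^N is a convex combination of the two sequences which
replace its coordinate n by 1 and by 0. Eliminating the coordinates below n
one after the other leads to vertices of the cube. *)
Lemma seminorm_unit_cube_aux n (x : nat -> R) :
  (forall k, 0 <= x k <= 1) ->
  (forall k, (n <= k)%N -> (x k == 0) || (x k == 1)) ->
  g (fun k => of_real b (x k)) <= M.
Proof.
elim: n x => [|n IHn] x x01 xn.
  rewrite (_ : (fun k => _) = (fun k => ((fun k => x k == 1) k)%:R)) ?gF//.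
  apply/funext => k; have /orP[/eqP->|/eqP->] := xn k isT.
    by rewrite of_real0 eq_sym oner_eq0.
  by rewrite of_real1 eqxx.
pose xe (e : R) k := if k == n then e else x k.
have xeP e : (e == 0) || (e == 1) -> g (fun k => of_real b (xe e k)) <= M.
  move=> e01; apply: IHn => k; rewrite /xe; case: (k =P n) => [_|/eqP kn].
  - by case/orP: e01 => /eqP->; rewrite lexx ler01.
  - exact: x01.
  - by [].
  - by move=> nk; apply: xn; rewrite ltn_neqAle eq_sym kn.
have /andP[l0 l1] := x01 n.
rewrite (_ : (fun k => _) = (fun k => of_real b (x n) * of_real b (xe 1 k) +
                               of_real b (1 - x n) * of_real b (xe 0 k))).
  apply: (le_trans (gD _ _)); rewrite !gZ !modulus_of_real.
  rewrite !ger0_norm// ?subr_ge0//.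
  rewrite (_ : M = x n * M + (1 - x n) * M); last by ring.
  by apply: lerD; apply: ler_wpM2l; rewrite ?subr_ge0//; apply: xeP;
    rewrite eqxx ?orbT.
apply/funext => k; rewrite -!of_realM -of_realD /xe; congr of_real.
by case: eqP => [->|_]; ring.
Qed.

Lemma seminorm_unit_cube (x : nat -> R) : (forall k, 0 <= x k <= 1) ->
  g (fun k => of_real b (x k)) <= M.
Proof.
move=> x01; pose x' k := if (k < m)%N then x k else 0.
rewrite (gm (y := fun k => of_real b (x' k)));
  last by move=> k km; rewrite /x' km.
apply: (seminorm_unit_cube_aux (n := m)) => k; rewrite /x'.
  by case: ifP => _; rewrite ?x01// lexx ler01.
by move=> mk; rewrite ltnNge mk eqxx.
Qed.

Lemma seminorm_real_cube (x : nat -> R) : (forall k, `|x k| <= 1) ->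
  g (fun k => of_real b (x k)) <= 2 * M.
Proof.
move=> x1.
rewrite (_ : (fun k => _) = (fun k => of_real b (Num.max (x k) 0) +
   of_real b (- 1) * of_real b (Num.max (- x k) 0))); last first.
  apply/funext => k; rewrite -of_realM -of_realD; congr of_real.
  by rewrite /Num.max; case: ifPn; case: ifPn => /=; lra.
apply: (le_trans (gD _ _)); rewrite gZ modulus_of_real normrN normr1 mul1r.
rewrite (_ : 2 * M = M + M); last by ring.
by apply: lerD; apply: seminorm_unit_cube => k; move: (x1 k);
  rewrite ler_norml /Num.max; case: ifPn; lra.
Qed.

(** Each of the real and imaginary parts is a difference of two sequences of
the unit cube, whence the factor 4. *)
Lemma seminorm_polydisc w : (forall k, modulus (w k) <= 1) -> g w <= 4 * M.
Proof.
move=> w1.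
rewrite (_ : w = (fun k => of_real b (re_part (w k)) +
   imag_unit R b * of_real b (im_part (w k)))); last first.
  by apply/funext => k; exact: re_im_decomp.
apply: (le_trans (gD _ _)); rewrite gZ.
rewrite (_ : 4 * M = 2 * M + 1 * (2 * M)); last by ring.
apply: lerD.
  by apply: seminorm_real_cube => k; apply: le_trans (w1 k); exact: re_part_le.
have im_le : g (fun k => of_real b (im_part (w k))) <= 2 * M.
  by apply: seminorm_real_cube => k; apply: le_trans (w1 k); exact: im_part_le.
apply: (le_trans (ler_wpM2l (modulus_ge0 _) im_le)).
by rewrite ler_wpM2r ?modulus_imag_unit// mulr_ge0// seminorm_ge0.
Qed.

End Seminorm.

(** Duality: the sum of the moduli is the modulus of the sum of z_n w_n when
the w_n are the phases, and w |-> |sum_n z_n w_n| is a seminorm whose values at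
0-1 sequences are the subsums. *)
Lemma sum_modulus_le (z : nat -> K) N M :
  (forall P : pred nat, modulus (\sum_(0 <= n < N | P n) z n) <= M) ->
  \sum_(0 <= n < N) modulus (z n) <= 4 * M.
Proof.
move=> hM; pose g w := modulus (\sum_(0 <= n < N) z n * w n).
have -> : \sum_(0 <= n < N) modulus (z n) = g (fun n => phase (z n)).
  rewrite /g; under [X in _ = modulus X]eq_bigr do rewrite mul_phase.
  rewrite -of_real_sum modulus_of_real ger0_norm// sumr_ge0// => n _.
  exact: modulus_ge0.
apply: (seminorm_polydisc (m := N)) => [x y|d x|x y xy|F|k].
- rewrite /g; under eq_bigr do rewrite mulrDr.
  by rewrite big_split; exact: modulusD.
- rewrite /g -modulusM big_distrr; congr modulus.
  by apply: eq_bigr => k _ /=; rewrite mulrCA.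
- by congr modulus; apply: eq_big_nat => k /andP[_ kN]; rewrite xy.
- rewrite (le_trans _ (hM F))// /g [X in _ <= modulus X]big_mkcond.
  rewrite le_eqVlt; apply/orP; left; apply/eqP; congr modulus.
  by apply: eq_bigr => k _; case: (F k); rewrite ?mulr1 ?mulr0.
- by rewrite modulus_phase.
Qed.

End Modulus.

(** * Real bounds for extended sums and suprema *)

Section Conversions.
Variable R : realType.

Lemma nneseries_leP (f : nat -> R) (B : R) : (forall n, 0 <= f n) ->
  (\sum_(0 <= n <oo) (f n)%:E <= B%:E)%E <->
  forall N, \sum_(0 <= n < N) f n <= B.
Proof.
move=> f0; split => [h N|h].
  rewrite -lee_fin -sumEFin (le_trans _ h)//; apply: nneseries_lim_ge => n _ _.
  by rewrite lee_fin.
apply: lime_le.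
  by apply: is_cvg_nneseries => n _ _; rewrite lee_fin.
by apply: nearW => N; rewrite sumEFin lee_fin.
Qed.

Lemma lty_boundP (x : \bar R) : (x < +oo)%E <-> exists B : R, (x <= B%:E)%E.
Proof.
split=> [|[B xB]]; last by rewrite (le_lt_trans xB)// ltry.
case: x => [x _|//|_]; first by exists x.
by exists 0; rewrite leNye.
Qed.

Lemma nneseries_ltyP (f : nat -> R) : (forall n, 0 <= f n) ->
  (\sum_(0 <= n <oo) (f n)%:E < +oo)%E <->
  exists B, forall N, \sum_(0 <= n < N) f n <= B.
Proof.
move=> f0; rewrite lty_boundP.
by split=> -[B hB]; exists B; apply/nneseries_leP.
Qed.

Lemma ereal_sup_ltyP (S : set (\bar R)) : (ereal_sup S < +oo)%E <->
  exists B : R, forall x, S x -> (x <= B%:E)%E.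
Proof.
by rewrite lty_boundP; split=> -[B /ereal_supP]; exists B => //;
  apply/ereal_supP.
Qed.

(** Common form of the suprema in H_1, H_3, H_4 and H_5. A predicate
restricted to an initial segment describes every finite set of indices, and
also the empty one, whence the condition on the value of Psi at 0. *)
Lemma sup_finite_sumsP (V : nmodType) (f : nat -> nat -> V)
    (Psi : (nat -> V) -> \bar R) : (Psi (fun=> 0%R) <= 0)%E ->
  (ereal_sup [set Psi (fun m => \sum_(i <- F) f i m)%R
     | F in finite_index_sets] < +oo)%E <->
  exists B : R, forall (P : pred nat) N,
    (Psi (fun m => \sum_(0 <= i < N | P i) f i m)%R <= B%:E)%E.
Proof.
move=> Psi0; rewrite ereal_sup_ltyP; split=> -[B hB].
  exists (Num.max B 0) => P N.
  pose F := [fset i in iota 0 N | P i]%fset.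
  have FE m : \sum_(i <- F) f i m = \sum_(0 <= i < N | P i) f i m.
    rewrite /index_iota subn0 -[RHS]big_filter; apply: perm_big.
    apply: uniq_perm; rewrite ?filter_uniq ?iota_uniq ?fset_uniq// => i.
    by rewrite !inE mem_filter andbC.
  under eq_fun do rewrite -FE.
  have [->|F0] := eqVneq F fset0.
    under eq_fun do rewrite big_seq_fset0.
    by rewrite (le_trans Psi0)// lee_fin le_max lexx orbT.
  rewrite (@le_trans _ _ B%:E) ?lee_fin ?le_max ?lexx//.
  by apply: hB; exists F.
exists B => _ [F _ <-].
pose N := (\max_(i <- F) i)%N.+1.
have FE m : \sum_(i <- F) f i m = \sum_(0 <= i < N | i \in F) f i m.
  rewrite -[RHS]big_filter; apply: perm_big; apply: uniq_perm.
  - exact: fset_uniq.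
  - by rewrite filter_uniq ?iota_uniq.
  - move=> i; rewrite mem_filter mem_index_iota leq0n /= ltnS.
    case iF : (i \in F) => //=; apply/esym.
    exact: (@leq_bigmax_seq _ (enum_fset F) xpredT id i).
by under eq_fun do rewrite FE; exact: hB.
Qed.

End Conversions.

(** * The gliding hump *)

(** A strictly increasing sequence m with m_0 = 0 cuts the indices into the
blocks [m_j, m_(j+1)). *)
Section Blocks.
Variable m : nat -> nat.
Hypotheses (m0 : m 0%N = 0%N) (m_incr : forall j, (m j < m j.+1)%N).

Lemma block_index k : exists j, (m j <= k < m j.+1)%N.
Proof.
elim: k => [|k [j /andP[jk kj]]];
  first by exists 0%N; have := m_incr 0; rewrite m0.
have [lt|ge] := ltnP k.+1 (m j.+1).
  by exists j; rewrite lt (leq_trans jk).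
by exists j.+1; rewrite ge (leq_ltn_trans kj).
Qed.

Lemma block_ends_mono i j : (i <= j)%N -> (m i <= m j)%N.
Proof.
by apply: (@homo_leq _ m leq) => [//|? ? ?|k];
   [exact: leq_trans|exact/ltnW/m_incr].
Qed.

Lemma block_index_ge i j k :
  (m i <= k)%N -> (m j <= k < m j.+1)%N -> (i <= j)%N.
Proof.
move=> ik /andP[_ kj]; rewrite leqNgt; apply/negP => ji.
by have := leq_trans kj (leq_trans (block_ends_mono ji) ik); rewrite ltnn.
Qed.

Lemma block_index_uniq i j k :
  (m i <= k < m i.+1)%N -> (m j <= k < m j.+1)%N -> i = j.
Proof.
move=> hi hj; apply/anti_leq.
case/andP: (hi) => ik _; case/andP: (hj) => jk _.
by rewrite (block_index_ge ik hj) (block_index_ge jk hi).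
Qed.

End Blocks.

Section GlidingHump.
Variables (R : realType) (b : scalar_kind).
Local Notation K := (scalars R b).
Variable C : nat -> nat -> K.
Implicit Types y z : nat -> K.

Definition maps_to_ell1 (X : set (nat -> K)) :=
  forall y, X y -> ell1 (lt_transform C y).

Definition partial_norm N y : R :=
  \sum_(0 <= n < N) modulus (lt_transform C y n).

Lemma ell1P y :
  ell1 (lt_transform C y) <-> exists B, forall N, partial_norm N y <= B.
Proof. by apply: nneseries_ltyP => n; exact: modulus_ge0. Qed.

Lemma partial_normD N y z :
  partial_norm N (fun k => y k + z k) <= partial_norm N y + partial_norm N z.
Proof.
rewrite /partial_norm -big_split; apply: ler_sum => n _ /=.
rewrite (_ : lt_transform _ _ _ = lt_transform C y n + lt_transform C z n).
  exact: modulusD.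
by rewrite /lt_transform -big_split; apply: eq_bigr => k _; rewrite mulrDr.
Qed.

Lemma partial_normZ N d y :
  partial_norm N (fun k => d * y k) = modulus d * partial_norm N y.
Proof.
rewrite /partial_norm big_distrr; apply: eq_bigr => n _ /=.
rewrite -modulusM /lt_transform big_distrr; congr modulus.
by apply: eq_bigr => k _ /=; rewrite mulrCA.
Qed.

Lemma partial_norm_ext N y z :
  (forall k, (k < N)%N -> y k = z k) -> partial_norm N y = partial_norm N z.
Proof.
move=> yz; apply: eq_big_nat => n /andP[_ nN]; congr modulus.
by apply: eq_big_nat => k /andP[_ kn]; rewrite yz// (leq_ltn_trans _ nN).
Qed.

Definition unit_seq i : nat -> K := fun k => (k == i)%:R.

(** A sequence with m nonzero coordinates is a combination of m unit
sequences, so the column bounds control it independently of N. *)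
Lemma partial_norm_head m N y (W col : nat -> R) :
  (forall k, modulus (y k) <= W k) ->
  (forall k, partial_norm N (unit_seq k) <= col k) ->
  partial_norm N (fun k => if (k < m)%N then y k else 0) <=
    \sum_(0 <= k < m) W k * col k.
Proof.
move=> yW colP; elim: m => [|m IHm].
  rewrite big_nil (_ : (fun _ => _) = (fun k => 0 * y k)).
    by rewrite partial_normZ modulus0 mul0r.
  by apply/funext => k; rewrite mul0r.
rewrite big_nat_recr//= (_ : (fun _ => _) = (fun k =>
  (if (k < m)%N then y k else 0) + y m * unit_seq m k)).
  rewrite (le_trans (partial_normD _ _ _))// lerD// partial_normZ.
  apply: ler_pM => //; first exact: modulus_ge0.
  by apply: sumr_ge0 => n _; exact: modulus_ge0.
apply/funext => k; rewrite /unit_seq ltnS leq_eqVlt.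
by case: eqP => [->|_]; rewrite ?ltnn ?mulr1 ?add0r// mulr0 addr0.
Qed.

Variables (X : set (nat -> K)) (P : nat -> set (nat -> K)) (W : nat -> R).
Hypothesis P_solid : forall j y z,
  (forall k, modulus (z k) <= modulus (y k)) -> P j y -> P j z.
Hypothesis P_bounded : forall j z k, P j z -> modulus (z k) <= W k.
Hypothesis X_unit : forall k, X (unit_seq k).
Hypothesis X_glue : forall (m : nat -> nat) y, m 0%N = 0%N ->
  (forall j, (m j < m j.+1)%N) ->
  (forall j, P j (fun k => if (m j <= k < m j.+1)%N then y k else 0)) -> X y.

(** Uniform boundedness. The coordinates of members of P_j are bounded by W,
so whatever is placed below the index m costs at most the constant A m. If
the conclusion fails, some member of P_j supported above m has partial norm
more than j + A m at some N; the next block starts beyond N, where nothing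
can alter the rows below N any more. *)
Lemma gliding_hump : maps_to_ell1 X ->
  exists j B, forall z, P j z -> forall N, partial_norm N z <= B.
Proof.
move=> CX.
have /choice[col colP] :
    forall k, exists B, forall N, partial_norm N (unit_seq k) <= B.
  by move=> k; apply/ell1P/CX.
pose A m := \sum_(0 <= k < m) W k * col k.
apply: contrapT => unbounded.
have /choice[f fP] : forall jm : nat * nat, exists zN : (nat -> K) * nat,
    [/\ P jm.1 zN.1, forall k, (k < jm.2)%N -> zN.1 k = 0 &
        jm.1%:R + A jm.2 < partial_norm zN.2 zN.1].
  move=> [j m] /=; apply: contrapT => noz; apply: unbounded.
  exists j, (j%:R + A m + A m) => z Pz N; rewrite leNgt; apply/negP => big.
  apply: noz; exists (fun k => if (k < m)%N then 0 else z k, N); split => /=.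
  - by apply: P_solid Pz => k; case: ifP; rewrite ?modulus0 ?modulus_ge0.
  - by move=> k ->.
  rewrite -(ltrD2r (A m)) (lt_le_trans big)//.
  rewrite (@partial_norm_ext N z (fun k => (if (k < m)%N then 0 else z k) +
    (if (k < m)%N then z k else 0))); last first.
    by move=> k _; case: ifP; rewrite ?add0r ?addr0.
  rewrite (le_trans (partial_normD _ _ _))// lerD2l.
  by apply: partial_norm_head => // k; exact: P_bounded Pz.
(* The maximum with m_j + 1 keeps the blocks nonempty. *)
pose m := fix m j :=
  if j is j'.+1 then maxn (f (j', m j')).2 (m j').+1 else 0%N.
have m_incr j : (m j < m j.+1)%N by rewrite /= leq_maxr.
have m0 : m 0%N = 0%N by [].
have /choice[J JP] := block_index m0 m_incr.
pose y k := (f (J k, m (J k))).1 k.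
have yE j k : (m j <= k < m j.+1)%N -> y k = (f (j, m j)).1 k.
  by move=> hk; rewrite /y (block_index_uniq m_incr (JP k) hk).
have [|B hB] := (ell1P y).1.
  apply/CX/(X_glue (m := m)) => // j; have [Pz _ _] := fP (j, m j).
  apply: P_solid Pz => k; case: ifP => [/yE->//|_].
  by rewrite modulus0 modulus_ge0.
have B0 : 0 <= B by apply: le_trans (hB 0%N); rewrite /partial_norm big_nil.
pose j := Num.bound B; have Bj : B < j%:R := archi_boundP B0.
have [_ z0] := fP (j, m j); set z := (f _).1; set N := (f _).2 => /=.
apply/negP; rewrite -leNgt.
rewrite (@partial_norm_ext N z (fun k => y k +
    of_real b (- 1) * (if (k < m j)%N then y k else 0))); last first.
  move=> k kN; case: ifPn => [km|]; rewrite ?mulr0 ?addr0.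
    rewrite (_ : z k = 0); last exact: z0.
    by rewrite of_realN1 mulN1r subrr.
  rewrite -leqNgt => mk; rewrite (@yE j)// mk /=.
  by rewrite (leq_trans kN)// leq_maxl.
rewrite (le_trans (partial_normD _ _ _))// partial_normZ modulus_of_real.
rewrite normrN normr1 mul1r; apply: lerD; first exact: le_trans (hB N) (ltW Bj).
apply: partial_norm_head => // k.
by have [Pz _ _] := fP (J k, m (J k)); exact: P_bounded Pz.
Qed.

End GlidingHump.

(** * Powers, rows and columns *)

Section RealSums.
Variable R : realType.

Lemma ler_sum_nat_widen (f : nat -> R) m N : (forall k, 0 <= f k) ->
  (m <= N)%N -> \sum_(0 <= k < m) f k <= \sum_(0 <= k < N) f k.
Proof.
move=> f0 mN; rewrite [leRHS](big_cat_nat (n := m)) //= lerDl.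
by apply: sumr_ge0.
Qed.

Lemma ler_sum_nat_head (f : nat -> R) m N : (forall k, 0 <= f k) ->
  \sum_(0 <= k < N) (if (k < m)%N then f k else 0) <= \sum_(0 <= k < m) f k.
Proof.
move=> f0; apply: (@le_trans _ _
    (\sum_(0 <= k < maxn m N) (if (k < m)%N then f k else 0))).
  by apply: ler_sum_nat_widen (leq_maxr _ _) => k; case: ifP.
rewrite (sum_nat_widen (leq_maxl m N)) => [|k mk]; last by rewrite ltnNge mk.
by rewrite le_eqVlt; apply/orP; left; apply/eqP/eq_big_nat => k /andP[_ ->].
Qed.

Lemma powR_le_root (x a e : R) : 0 <= x -> 0 <= a -> 0 < e ->
  (x `^ e <= a) = (x <= a `^ e^-1).
Proof.
move=> x0 a0 e0; apply/idP/idP => h.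
  rewrite -[x]powRr1// -(@divff _ e) ?gt_eqF// powRrM.
  by apply: ge0_ler_powR; rewrite ?nnegrE ?powR_ge0 ?invr_ge0 ?(ltW e0).
rewrite -[a]powRr1// -(@mulVf _ e) ?gt_eqF// powRrM.
by apply: ge0_ler_powR; rewrite ?nnegrE ?powR_ge0 ?(ltW e0).
Qed.

Lemma powR_rootK (a e : R) : 0 <= a -> 0 < e -> (a `^ e^-1) `^ e = a.
Proof. by move=> a0 e0; rewrite -powRrM mulVf ?gt_eqF// powRr1. Qed.

Lemma powR_le1 (x e : R) : 0 <= x -> 0 < e -> (x `^ e <= 1) = (x <= 1).
Proof. by move=> x0 e0; rewrite powR_le_root ?ler01// powR1. Qed.

Lemma le_powR_small (x e : R) : 0 <= x <= 1 -> 0 < e <= 1 -> x <= x `^ e.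
Proof.
move=> /andP[]; rewrite le_eqVlt => /predU1P[<- _ _|x0 x1 /andP[_ e1]].
  exact: powR_ge0.
by apply: ger1_powR; rewrite ?x0.
Qed.

(** A form of Young's inequality without the constants: compare x with
y^(e - 1), which is the boundary where both powers equal x y. *)
Lemma mul_le_powR_conj (x y e : R) : 0 <= x -> 0 <= y -> 1 < e ->
  x * y <= x `^ (e / (e - 1)) + y `^ e.
Proof.
move=> x0 y0 e1; have e0 : 0 < e by lra.
have e10 : 0 < e - 1 by lra.
have c0 : 0 < e / (e - 1) by rewrite divr_gt0.
have [xy|yx] := leP x (y `^ (e - 1)).
  rewrite -[leLHS]add0r lerD ?powR_ge0// mulrC -(mulr_powRB1 y0 e0).
  exact: ler_wpM2l.
rewrite -[leLHS]addr0 lerD ?powR_ge0// -(mulr_powRB1 x0 c0).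
apply: ler_wpM2l => //.
have -> : e / (e - 1) - 1 = (e - 1)^-1 by field; rewrite gt_eqF.
by rewrite -powR_le_root// ltW.
Qed.

End RealSums.

Section MatrixSums.
Variables (K : fieldType) (C : nat -> nat -> K).
Hypothesis C_low : lower_triangular C.

Lemma row_sumE (F : pred nat) M (a : nat -> K) n :
  \sum_(0 <= k < M | F k) C n k * a k =
  lt_transform C (fun k => if F k && (k < M)%N then a k else 0) n.
Proof.
pose h k := C n k * (if F k && (k < M)%N then a k else 0).
rewrite -[RHS](@sum_nat_widen _ h n.+1 (maxn M n.+1)) ?leq_maxr//; last first.
  by move=> k nk; rewrite /h C_low ?mul0r.
rewrite (@sum_nat_widen _ h M) ?leq_maxl//; last first.
  by move=> k Mk; rewrite /h ltnNge Mk andbF mulr0.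
rewrite big_mkcond; apply: eq_big_nat => k /andP[_ kM].
by rewrite /h kM andbT; case: (F k); rewrite ?mulr0.
Qed.

Lemma col_sumE (F : pred nat) M N (a : nat -> K) :
  \sum_(0 <= n < M | F n)
     lt_transform C (fun k => if (k < N)%N then a k else 0) n =
  \sum_(0 <= k < N) (\sum_(0 <= n < M | F n) C n k) * a k.
Proof.
under eq_bigr => n _.
  have <- := row_sumE predT N a n.
  over.
by rewrite exchange_big; apply: eq_bigr => k _ /=; rewrite big_distrl.
Qed.

End MatrixSums.

(** * Triangles mapping a Maddox space into l_1 *)

Section Characterisations.
Variables (R : realType) (b : scalar_kind).
Local Notation K := (scalars R b).
Variables (C : nat -> nat -> K) (p : nat -> R).
Hypotheses (C_low : lower_triangular C) (p_gt0 : forall k, 0 < p k).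
Implicit Types y z : nat -> K.

Local Notation q := (partial_norm C).

Lemma modulus_powR_unit k i : modulus (unit_seq R b i k) `^ p k = (k == i)%:R.
Proof.
rewrite /unit_seq; case: eqP => _; first by rewrite modulus1 powR1.
by rewrite modulus0 powR0// gt_eqF.
Qed.

Lemma maddox_linftyP y : maddox_linfty p y <->
  exists B, forall k, modulus (y k) `^ p k <= B.
Proof.
rewrite /maddox_linfty /= ereal_sup_ltyP; split=> -[B hB]; exists B.
  by move=> k; rewrite -lee_fin; apply: hB; exists k.
by move=> _ [k _ <-]; rewrite lee_fin.
Qed.

Lemma maddox_c0P y : maddox_c0 p y <->
  forall e : R, 0 < e ->
  exists N, forall k, (N <= k)%N -> modulus (y k) `^ p k <= e.
Proof.
rewrite /maddox_c0 /=; split=> [/cvgrPdist_le h e /h[N _ hN]|h].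
  exists N => k /hN; rewrite sub0r normrN; exact: le_trans (ler_norm _).
apply/cvgrPdist_le => e /h[N hN]; exists N => // k /hN hk /=.
by rewrite sub0r normrN ger0_norm ?powR_ge0.
Qed.

Lemma maddox_lP y : maddox_l p y <->
  exists B, forall N, \sum_(0 <= k < N) modulus (y k) `^ p k <= B.
Proof. by apply: nneseries_ltyP => k; exact: powR_ge0. Qed.

Definition weighted_bounded (w : nat -> R) := exists B,
  forall (F : pred nat) M N, \sum_(0 <= n < N)
    modulus (\sum_(0 <= k < M | F k) C n k * of_real b (w k)) <= B.

Lemma weighted_sumE (F : pred nat) M N (w : nat -> R) :
  \sum_(0 <= n < N) modulus (\sum_(0 <= k < M | F k) C n k * of_real b (w k)) =
  q N (fun k => if F k && (k < M)%N then of_real b (w k) else 0).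
Proof.
apply: eq_bigr => n _; congr modulus.
exact: (row_sumE C_low F M (fun k => of_real b (w k))).
Qed.

(** Dividing y by c w brings it into the polydisc, where 0-1 sequences
decide. *)
Lemma weighted_bounded_maps w y c : weighted_bounded w ->
  (forall k, 0 < w k) -> 0 < c -> (forall k, modulus (y k) <= c * w k) ->
  ell1 (lt_transform C y).
Proof.
move=> [B hB] w0 c0 yw; apply/ell1P; exists (4 * (c * B)) => N.
pose d k := of_real b (c * w k).
have d0 k : d k != 0.
  apply/eqP => /(congr1 (@modulus R b)); rewrite modulus_of_real modulus0.
  by move/eqP; rewrite normr_eq0 gt_eqF ?mulr_gt0.
rewrite (_ : y = (fun k => d k * (y k / d k))); last first.
  by apply/funext => k; rewrite mulrCA divff ?mulr1.
apply: (@seminorm_polydisc R b (fun x => q N (fun k => d k * x k)) _ N).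
- move=> x z; under eq_fun do rewrite mulrDr.
  exact: partial_normD.
- move=> e x; under eq_fun do rewrite mulrCA.
  exact: partial_normZ.
- by move=> x z xz; apply: partial_norm_ext => k kN; rewrite xz.
- move=> F; rewrite (@partial_norm_ext _ _ C N _ (fun k => of_real b c *
      (if F k && (k < N)%N then of_real b (w k) else 0))); last first.
    move=> k kN; rewrite kN andbT /d of_realM.
    by case: (F k); rewrite ?mulr1 ?mulr0.
  rewrite partial_normZ modulus_of_real gtr0_norm// -weighted_sumE.
  by rewrite ler_pM2l.
- move=> k; rewrite modulusM modulusV modulus_of_real gtr0_norm ?mulr_gt0//.
  by rewrite ler_pdivrMr ?mulr_gt0// mul1r.
Qed.

(** For a sequence y of c_0(p), |y_k| <= L^(-1/p_k) from some index on, and the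
finitely many other coordinates only cost a constant factor. Conversely the
uniform bound holds on a set defined by |z_k|^p_k <= 1/L for all k, and the
sequences with values L^(-1/p_k) and 0 belong to it. *)
Lemma maps_c0P : maps_to_ell1 C (maddox_c0 p) <->
  exists2 L, (0 < L)%N & weighted_bounded (fun k => L%:R `^ (- (p k)^-1)).
Proof.
split=> [Cc0|[L L0 hL] y /maddox_c0P yc0]; last first.
  have Lpos : (0 : R) < L%:R by rewrite ltr0n.
  pose w k := (L%:R : R) `^ (- (p k)^-1).
  have w0 k : 0 < w k by rewrite powR_gt0.
  have Linv0 : (0 : R) < L%:R^-1 by rewrite invr_gt0.
  have [N hN] := yc0 _ Linv0.
  pose c := 1 + \sum_(0 <= k < N) modulus (y k) / w k.
  have yw0 k : 0 <= modulus (y k) / w k.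
    by rewrite divr_ge0 ?modulus_ge0 ?ltW.
  have c1 : 1 <= c by rewrite lerDl sumr_ge0.
  apply: (weighted_bounded_maps hL w0 (lt_le_trans ltr01 c1)) => k.
  rewrite -ler_pdivrMr; last exact: w0.
  have [Nk|kN] := leqP N k.
    apply: le_trans c1; rewrite ler_pdivrMr ?w0// mul1r.
    have := hN k Nk; rewrite powR_le_root ?modulus_ge0 ?invr_ge0 ?(ltW Lpos)//.
    by rewrite -[L%:R^-1]powR_inv1 ?(ltW Lpos)// -powRrM mulN1r.
  rewrite /c (bigD1_seq k) ?mem_index_iota ?iota_uniq//= addrCA lerDl.
  by rewrite addr_ge0// sumr_ge0.
pose P (j : nat) : set (nat -> K) :=
  [set z | forall k, modulus (z k) `^ p k <= j.+1%:R^-1].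
have [|||||j [B hB]] := @gliding_hump R b C (maddox_c0 p) P (fun=> 1).
- move=> j y z zy Py k; apply: le_trans (Py k).
  by apply: ge0_ler_powR; rewrite ?nnegrE ?modulus_ge0 ?(ltW (p_gt0 k)).
- move=> j z k /(_ k); rewrite -(@powR_le1 _ _ (p k)) ?modulus_ge0//.
  by move/le_trans; apply; rewrite invf_le1 ?ltr0n// ler1n.
- move=> i; apply/maddox_c0P => e e0; exists i.+1 => k ik.
  by rewrite modulus_powR_unit gtn_eqF// ltW.
- move=> m y m0 m_incr Py; apply/maddox_c0P => e e0.
  pose i := Num.bound e^-1.
  exists (m i) => k mik; have [j jk] := block_index m0 m_incr k.
  have ij := block_index_ge m_incr mik jk.
  have := Py j k; rewrite jk => /le_trans; apply.
  rewrite invf_ple ?posrE ?ltr0n//; apply: le_trans (ltW (archi_boundP _)) _.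
    by rewrite invr_ge0 ltW.
  by rewrite ler_nat -/i leqW.
- exact: Cc0.
exists j.+1 => //; exists B => F M N; rewrite weighted_sumE; apply: hB => k.
case: ifP => _; last first.
  by rewrite modulus0 powR0 ?gt_eqF// invr_ge0.
rewrite modulus_of_real ger0_norm ?powR_ge0// -powRrM mulNr mulVf ?gt_eqF//.
by rewrite powR_inv1.
Qed.

(** For each L the gliding hump is used with one fixed set, |z_k|^p_k <= L for
all k: gluing blocks taken from it gives again a member of it. *)
Lemma maps_linftyP : maps_to_ell1 C (maddox_linfty p) <->
  forall L, (0 < L)%N -> weighted_bounded (fun k => L%:R `^ (p k)^-1).
Proof.
split=> [Cl L L0|hL y /maddox_linftyP[B hB]]; last first.
  have B0 : 0 <= B by rewrite (le_trans _ (hB 0%N)) ?powR_ge0.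
  pose L := (Num.bound B).+1.
  have BL : B <= L%:R.
    by rewrite (le_trans (ltW (archi_boundP B0)))// ler_nat leqnSn.
  apply: (weighted_bounded_maps (hL L isT) _ ltr01) => k.
    by rewrite powR_gt0.
  by rewrite mul1r -powR_le_root ?modulus_ge0// (le_trans (hB k)).
pose P (j : nat) : set (nat -> K) :=
  [set z | forall k, modulus (z k) `^ p k <= L%:R].
have [|||||j [B hB]] := @gliding_hump R b C (maddox_linfty p) P
    (fun k => L%:R `^ (p k)^-1).
- move=> j y z zy Py k; apply: le_trans (Py k).
  by apply: ge0_ler_powR; rewrite ?nnegrE ?modulus_ge0 ?(ltW (p_gt0 k)).
- by move=> j z k /(_ k); rewrite powR_le_root ?modulus_ge0.
- move=> i; apply/maddox_linftyP; exists 1 => k; rewrite modulus_powR_unit.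
  by case: eqP.
- move=> m y m0 m_incr Py; apply/maddox_linftyP; exists L%:R => k.
  by have [j jk] := block_index m0 m_incr k; have := Py j k; rewrite jk.
- exact: Cl.
exists B => F M N; rewrite weighted_sumE; apply: hB => k.
case: ifP => _; last by rewrite modulus0 powR0 ?gt_eqF.
by rewrite modulus_of_real ger0_norm ?powR_ge0// powR_rootK.
Qed.

Lemma maps_cP : maps_to_ell1 C (maddox_c p) <->
  maps_to_ell1 C (maddox_c0 p) /\ ell1 (lt_transform C (fun=> 1)).
Proof.
split=> [Cc|[Cc0 C1] y [l yl]]; first split.
- move=> y yc0; apply: Cc; exists 0.
  by under eq_fun do rewrite subr0.
- apply: Cc; exists 1; apply: cvg_near_cst; apply: nearW => k.
  by rewrite subrr modulus0 powR0// gt_eqF.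
have /ell1P[B hB] := Cc0 (fun k => y k - l) yl.
have /ell1P[B' hB'] := C1.
apply/ell1P; exists (B + modulus l * B') => N.
rewrite (_ : y = (fun k => (y k - l) + l * 1)); last first.
  by apply/funext => k; rewrite mulr1 subrK.
apply: (le_trans (partial_normD _ _ _ _)); rewrite partial_normZ.
by rewrite lerD// ler_wpM2l ?modulus_ge0.
Qed.

Lemma modulus_col_sum_le (F : pred nat) M z :
  modulus (\sum_(0 <= n < M | F n) lt_transform C z n) <= q M z.
Proof.
apply: (le_trans (modulus_sum _ _ _)); rewrite big_mkcond.
by apply: ler_sum => n _; case: ifP => // _; exact: modulus_ge0.
Qed.

(** The finite sets of rows act as test functionals; exchanging the two sums
expresses them through the column sums. *)
Lemma ell1_of_col_sums y B : (forall (F : pred nat) N,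
    modulus (\sum_(0 <= k < N) (\sum_(0 <= n < N | F n) C n k) * y k) <= B) ->
  ell1 (lt_transform C y).
Proof.
move=> hB; apply/ell1P; exists (4 * B) => N; apply: sum_modulus_le => F.
apply: le_trans (hB F N); rewrite -col_sumE// le_eqVlt; apply/orP; left.
apply/eqP; congr modulus; rewrite big_nat_cond [RHS]big_nat_cond.
apply: eq_bigr => n /andP[/andP[_ nN] _]; apply: eq_big_nat => k /andP[_ kn].
by rewrite (leq_ltn_trans _ nN).
Qed.

(** The sum of the |z_k|^p_k over the j-th block is at most 2^-j, so it is at
most 2 for the glued sequence. *)
Lemma maddox_l_hump : maps_to_ell1 C (maddox_l p) ->
  exists2 eta : R, 0 < eta & exists B, forall z,
    (forall N, \sum_(0 <= k < N) modulus (z k) `^ p k <= eta) ->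
    forall N, q N z <= B.
Proof.
move=> Cl; pose P (j : nat) : set (nat -> K) :=
  [set z | forall N, \sum_(0 <= k < N) modulus (z k) `^ p k <= 2^-1 ^+ j].
have pow0 z k : 0 <= modulus (z k) `^ p k by exact: powR_ge0.
have [|||||j hB] := @gliding_hump R b C (maddox_l p) P (fun=> 1).
- move=> j y z zy Py N; apply: le_trans (Py N); apply: ler_sum => k _.
  by apply: ge0_ler_powR; rewrite ?nnegrE ?modulus_ge0 ?(ltW (p_gt0 k)).
- move=> j z k /(_ k.+1); rewrite big_nat_recr//= => h.
  rewrite -(@powR_le1 _ _ (p k)) ?modulus_ge0//.
  apply: (@le_trans _ _ (2^-1 ^+ j)); last by rewrite exprn_ile1//; lra.
  by apply: le_trans h; rewrite lerDr sumr_ge0.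
- move=> i; apply/maddox_lP; exists 1 => N.
  under eq_bigr do rewrite modulus_powR_unit.
  have [iN|Ni] := ltnP i N; last first.
    by rewrite big_nat big1 ?ler01// => k /andP[_ kN];
      rewrite ltn_eqF// (leq_trans kN).
  rewrite (bigD1_seq i) ?mem_index_iota ?iota_uniq//= eqxx big1 ?addr0//.
  by move=> k /negbTE->.
- move=> m y m0 m_incr Py; apply/maddox_lP; exists 2 => N.
  have mN : (N <= m N)%N
    by elim: N => // N IHN; exact: leq_ltn_trans (m_incr N).
  apply: le_trans (ler_sum_nat_widen (pow0 y) mN) _.
  apply: (@le_trans _ _ (2 - 2 * 2^-1 ^+ N)); last first.
    by rewrite gerDl oppr_le0 mulr_ge0// exprn_ge0.
  elim: {mN} N => [|N IHN]; first by rewrite m0 big_nil expr0 mulr1 subrr.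
  rewrite (big_cat_nat (n := m N)) ?(ltnW (m_incr N))//=.
  rewrite (_ : 2 - _ = 2 - 2 * 2^-1 ^+ N + 2^-1 ^+ N); last first.
    by rewrite exprS; field.
  apply: lerD => //; have := Py N (m N.+1).
  rewrite (big_cat_nat (n := m N)) ?(ltnW (m_incr N))//=.
  rewrite (eq_big_nat (m := m N) _ _ (F2 := fun k => modulus (y k) `^ p k)).
    by apply: le_trans; rewrite lerDr sumr_ge0// => k _; exact: powR_ge0.
  by move=> k ->.
- exact: Cl.
by exists (2^-1 ^+ j) => //; rewrite exprn_gt0.
Qed.

(** If B |y_k|^p_k <= 1 then, with c_k a column sum, |c_k y_k|^p_k <= 1, so
|c_k y_k| is at most its own p_k-th power and is summable; this holds from
some index on because |y_k|^p_k tends to 0. For the converse, the test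
sequences have the single entry eta^(1/p_k). *)
Lemma maps_l_le1P : (forall k, p k <= 1) -> maps_to_ell1 C (maddox_l p) <->
  exists B, forall (F : pred nat) M k,
    modulus (\sum_(0 <= n < M | F n) C n k) `^ p k <= B.
Proof.
move=> p1; split=> [/maddox_l_hump[eta eta0 [B hB]]|[B' hB'] y yl]; last first.
  pose B := Num.max B' 1.
  have B1 : 1 <= B by rewrite le_max lexx orbT.
  have B0 : 0 < B by apply: lt_le_trans B1.
  have hB F M k : modulus (\sum_(0 <= n < M | F n) C n k) `^ p k <= B.
    by rewrite (le_trans (hB' F M k))// le_max lexx.
  have /maddox_lP[G hG] := yl.
  have [K0 hK] : exists N, forall k, (N <= k)%N -> modulus (y k) `^ p k <= B^-1.
    have : maddox_c0 p y.
      apply: cvg_series_cvg_0; apply: nondecreasing_is_cvgn.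
        move=> i j ij; apply: ler_sum_nat_widen ij => k; exact: powR_ge0.
      by exists G => _ [N _ <-]; exact: hG.
    by move/maddox_c0P; apply; rewrite invr_gt0.
  pose h k := B `^ (p k)^-1 * modulus (y k).
  have h0 k : 0 <= h k by rewrite mulr_ge0 ?powR_ge0 ?modulus_ge0.
  apply: (@ell1_of_col_sums _ (\sum_(0 <= k < K0) h k + B * G)) => F N.
  apply: (le_trans (modulus_sum _ _ _)).
  apply: (@le_trans _ _ (\sum_(0 <= k < N) ((if (k < K0)%N then h k else 0) +
      B * modulus (y k) `^ p k))); last first.
    rewrite big_split /= -big_distrr /= lerD ?ler_sum_nat_head//.
    by rewrite ler_wpM2l// ltW.
  apply: ler_sum => k _; rewrite modulusM.
  set c := modulus (\sum_(_ <= _ < _ | _) _).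
  have c0 : 0 <= c by exact: modulus_ge0.
  have yk0 := modulus_ge0 (y k).
  have Byk0 : 0 <= B * modulus (y k) `^ p k by rewrite mulr_ge0 ?powR_ge0 ?ltW.
  case: ltnP => [_|Kk].
    rewrite -[leLHS]addr0 lerD// ler_wpM2r// -powR_le_root// ?(ltW B0)//.
    exact: hB.
  have le1 : (c * modulus (y k)) `^ p k <= B * modulus (y k) `^ p k.
    by rewrite powRM// ler_wpM2r ?powR_ge0// hB.
  rewrite add0r (le_trans _ le1)// le_powR_small ?p_gt0 ?p1// mulr_ge0//=.
  rewrite -(@powR_le1 _ _ (p k)) ?mulr_ge0// (le_trans le1)//.
  by rewrite -ler_pdivlMl// mulr1 hK.
(* A bound at least 1 dominates its p_k-th power, as p_k <= 1. *)
pose B1 := Num.max B 1.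
have B11 : 1 <= B1 by rewrite le_max lexx orbT.
exists (B1 / eta) => F M k; set c := \sum_(_ <= _ < _ | _) _.
pose e := of_real b (eta `^ (p k)^-1).
have ez i : (if (i == k) && (i < k.+1)%N then e else 0) = e * unit_seq R b k i.
  by rewrite /unit_seq; case: eqP => [->|_]; rewrite ?ltnSn ?mulr1 ?mulr0.
have := le_trans (modulus_col_sum_le F M
  (fun i => e * unit_seq R b k i)) (hB _ _ _).
have -> : \sum_(0 <= n < M | F n)
    lt_transform C (fun i => e * unit_seq R b k i) n = c * e.
  rewrite /c big_distrl; apply: eq_bigr => n _ /=.
  under eq_fun do rewrite -ez.
  rewrite -(row_sumE C_low (pred1 k) k.+1 (fun=> e)) big_mkcond big_nat_recr//=.
  by rewrite eqxx big_nat big1 ?add0r// => i /andP[_ ik]; rewrite ltn_eqF.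
rewrite modulusM modulus_of_real ger0_norm ?powR_ge0// => h.
have {}h : modulus c * eta `^ (p k)^-1 <= B1.
  rewrite (le_trans (h _))// ?le_max ?lexx// => N.
  apply: (@le_trans _ _ (\sum_(0 <= i < N) (if (i < k.+1)%N then
      if i == k then eta else 0 else 0))).
    apply: ler_sum => i _; rewrite -ez; case: (i == k) / eqP => [->|_] /=.
      by rewrite ltnSn modulus_of_real ger0_norm ?powR_ge0//
        powR_rootK ?(ltW eta0).
    by rewrite modulus0 powR0 ?gt_eqF//; case: ifP.
  apply: le_trans (ler_sum_nat_head _ _ _) _.
    by move=> i; case: eqP => // _; exact: ltW.
  rewrite big_nat_recr//= eqxx big_nat big1 ?add0r// => i /andP[_ ik].
  by rewrite ltn_eqF.
rewrite ler_pdivlMr// -[in leLHS](@powR_rootK _ eta (p k)) ?(ltW eta0)//.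
rewrite -powRM ?modulus_ge0 ?powR_ge0//.
apply: (@le_trans _ _ (B1 `^ p k)); last by apply: ler1_powR.
apply: ge0_ler_powR; rewrite ?nnegrE ?mulr_ge0 ?modulus_ge0 ?powR_ge0//.
  exact: ltW.
exact: le_trans ler01 B11.
Qed.

(** Sufficiency is Young's inequality. For necessity, let c_k be the column
sums, x_k = |c_k| / L and S the sum of the x_k^p'_k, and suppose S > eta. The
test sequence has moduli x_k^(p'_k - 1), the case of equality in Young's
inequality, multiplied by th^(1/p_k) with th = eta / S, so that its p_k-th
powers add up to eta. As th < 1 < p_k, the functional is at least
L th S = L eta at this sequence, which exceeds B by the choice of L. *)
Lemma maps_l_gt1P : (forall k, 1 < p k) -> maps_to_ell1 C (maddox_l p) <->
  exists2 L, (0 < L)%N & exists B, forall (F : pred nat) M N,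
    \sum_(0 <= k < N)
      (modulus (\sum_(0 <= n < M | F n) C n k) / L%:R) `^
        (p k / (p k - 1)) <= B.
Proof.
move=> p1; split=> [/maddox_l_hump[eta eta0 [B hB]]|[L L0 [B hB]] y];
  last first.
  move=> /maddox_lP[G hG].
  have Lpos : (0 : R) < L%:R by rewrite ltr0n.
  apply: (@ell1_of_col_sums _ (L%:R * (B + G))) => F N.
  apply: (le_trans (modulus_sum _ _ _)).
  apply: le_trans (ler_wpM2l (ltW Lpos) (lerD (hB F N N) (hG N))).
  rewrite -big_split big_distrr; apply: ler_sum => k _ /=; rewrite modulusM.
  set c := modulus (\sum_(_ <= _ < _ | _) _).
  rewrite (_ : c * _ = L%:R * (c / L%:R * modulus (y k))); last first.
    by field; rewrite gt_eqF.
  rewrite ler_wpM2l ?(ltW Lpos)//; apply: mul_le_powR_conj => //.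
    by rewrite divr_ge0 ?modulus_ge0 ?ltW.
  exact: modulus_ge0.
have B0 : 0 <= B.
  apply: le_trans (hB (fun=> 0) _ 0%N); first by rewrite /partial_norm big_nil.
  by move=> N; rewrite big1 ?(ltW eta0)// => k _;
    rewrite modulus0 powR0// gt_eqF.
pose L := (Num.bound (B / eta)).+1.
have BL : B < L%:R * eta.
  rewrite -ltr_pdivrMr// (lt_le_trans (archi_boundP _)) ?divr_ge0 ?(ltW eta0)//.
  by rewrite ler_nat leqnSn.
have Lpos : (0 : R) < L%:R by rewrite ltr0n.
exists L => //; exists eta => F M N.
pose c k := \sum_(0 <= n < M | F n) C n k; pose x k := modulus (c k) / L%:R.
have x0 k : 0 <= x k by rewrite divr_ge0 ?modulus_ge0 ?ltW.
pose p' k := p k / (p k - 1).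
have p10 k : 0 < p k - 1 by rewrite subr_gt0.
have p'0 k : 0 < p' k by rewrite divr_gt0.
rewrite -/(\sum_(0 <= k < N) x k `^ p' k) leNgt; apply/negP.
set S := \sum_(_ <= _ < _) _ => etaS.
have S0 : 0 < S := lt_trans eta0 etaS.
pose th := eta / S; have th0 : 0 < th by rewrite divr_gt0.
have th1 : th <= 1 by rewrite ler_pdivrMr// mul1r ltW.
pose a k := of_real b (th `^ (p k)^-1 * x k `^ (p' k - 1)) * phase (c k).
pose z k := if (k < N)%N then a k else 0.
have za k : modulus (a k) `^ p k = th * x k `^ p' k.
  rewrite modulusM modulus_phase mulr1 modulus_of_real.
  rewrite ger0_norm ?mulr_ge0 ?powR_ge0// powRM ?powR_ge0//.
  rewrite powR_rootK ?(ltW th0)// -powRrM; congr (_ * _ `^ _).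
  by rewrite /p'; field; rewrite gt_eqF.
have zeta : forall m, \sum_(0 <= k < m) modulus (z k) `^ p k <= eta.
  move=> m; apply: (@le_trans _ _ (\sum_(0 <= k < m)
      if (k < N)%N then th * x k `^ p' k else 0)).
    apply: ler_sum => k _; rewrite /z; case: ifP => _; first by rewrite za.
    by rewrite modulus0 powR0 ?gt_eqF.
  apply: le_trans (ler_sum_nat_head _ _ _) _.
    by move=> k; rewrite mulr_ge0 ?powR_ge0 ?ltW.
  by rewrite -big_distrr /= -/S /th divfK// gt_eqF.
have := le_trans (modulus_col_sum_le F M z) (hB z zeta M).
apply/negP; rewrite -ltNge (lt_le_trans BL)// /z col_sumE//.
rewrite (eq_bigr (fun k => of_real b (L%:R * (th `^ (p k)^-1 * x k `^ p' k)))).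
  rewrite -of_real_sum modulus_of_real -big_distrr /= normrM gtr0_norm//.
  rewrite ler_wpM2l ?(ltW Lpos)// (le_trans _ (ler_norm _))//.
  rewrite (_ : eta = th * S); last by rewrite /th divfK// gt_eqF.
  rewrite big_distrr; apply: ler_sum => k _ /=.
  rewrite ler_wpM2r ?powR_ge0// ger1_powR ?th0// invf_le1 ?(ltW (p1 k))//.
move=> k _; rewrite -/(c k) /a mulrCA mul_phase -of_realM; congr of_real.
rewrite -(mulr_powRB1 (x0 k) (p'0 k)) /x; field; rewrite gt_eqF//.
Qed.

End Characterisations.

(** * The alpha-duals *)

Section Assembly.
Variables (R : realType) (b : scalar_kind).
Local Notation K := (scalars R b).
Variables (r s t : nat -> K) (u v : K) (p : nat -> R).
Local Notation c := (c_coef r s t u v).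
Implicit Types a : nat -> K.

Lemma weighted_supP a (w : nat -> R) :
  (ereal_sup [set \sum_(0 <= n <oo) (modulus
       (\sum_(k <- F) c a n k * of_real b (w k)))%:E
     | F in finite_index_sets] < +oo)%E <-> weighted_bounded (c a) w.
Proof.
pose Psi (x : nat -> K) := (\sum_(0 <= n <oo) (modulus (x n))%:E)%E.
have Psi0 : (Psi (fun=> 0%R) <= 0)%E.
  by apply/nneseries_leP => [n|N]; rewrite ?modulus_ge0//;
    rewrite big1// => n; rewrite modulus0.
rewrite (sup_finite_sumsP (fun k n => c a n k * of_real b (w k)) Psi0).
split=> -[B hB]; exists B => F M.
  by apply/nneseries_leP => [n|]; [exact: modulus_ge0|exact: hB].
by apply/nneseries_leP => [n|N]; [exact: modulus_ge0|exact: hB].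
Qed.

Lemma H1P a : H1 r s t u v p a <-> exists2 L, (0 < L)%N &
  weighted_bounded (c a) (fun k => L%:R `^ (- (p k)^-1)).
Proof.
by split=> -[L L0 /weighted_supP]; exists L => //; apply/weighted_supP.
Qed.

Lemma H3P a : H3 r s t u v p a <-> forall L, (0 < L)%N ->
  weighted_bounded (c a) (fun k => L%:R `^ (p k)^-1).
Proof. by split=> h L /h /weighted_supP; [|apply]. Qed.

Lemma H2P a : H2 r s t u v a <-> ell1 (lt_transform (c a) (fun=> 1)).
Proof.
rewrite (_ : lt_transform _ _ = fun n => \sum_(0 <= k < n.+1) c a n k) //.
by apply/funext => n; apply: eq_bigr => k _; rewrite mulr1.
Qed.

Lemma H4P a : (forall k, 0 < p k) -> H4 r s t u v p a <->
  exists B, forall (F : pred nat) M k,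
    modulus (\sum_(0 <= n < M | F n) c a n k) `^ p k <= B.
Proof.
move=> p0; rewrite /H4 /=.
pose Psi (x : nat -> K) :=
  ereal_sup (range (fun k => (modulus (x k) `^ p k)%:E)).
have PsiP x B : (Psi x <= B%:E)%E <-> forall k, modulus (x k) `^ p k <= B.
  split=> [/ereal_supP h k|h]; first by rewrite -lee_fin; apply: h; exists k.
  by apply/ereal_supP => _ [k _ <-]; rewrite lee_fin.
have Psi0 : (Psi (fun=> 0%R) <= 0)%E.
  by apply/PsiP => k; rewrite modulus0 powR0 ?gt_eqF.
rewrite (sup_finite_sumsP (c a) Psi0).
by split=> -[B hB]; exists B => F M; apply/PsiP/hB.
Qed.

Lemma of_real_nat n : of_real b (n%:R : R) = n%:R.
Proof.
by elim: n => [|n IHn]; rewrite ?of_real0// !mulrS of_realD IHn of_real1.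
Qed.

Lemma H5P a : (forall k, 1 < p k) -> H5 r s t u v p a <->
  exists2 L, (0 < L)%N & exists B, forall (F : pred nat) M N,
    \sum_(0 <= k < N) (modulus (\sum_(0 <= n < M | F n) c a n k) / L%:R) `^
      (p k / (p k - 1)) <= B.
Proof.
move=> p1; pose Psi (x : nat -> K) :=
  (\sum_(0 <= k <oo) (modulus (x k) `^ (p k / (p k - 1)))%:E)%E.
have e0 k : p k / (p k - 1) != 0.
  by rewrite gt_eqF// divr_gt0 ?subr_gt0// (lt_trans ltr01).
have PsiP x B : (Psi x <= B%:E)%E <->
    forall N, \sum_(0 <= k < N) modulus (x k) `^ (p k / (p k - 1)) <= B.
  by apply: nneseries_leP => k; exact: powR_ge0.
have Psi0 : (Psi (fun=> 0%R) <= 0)%E.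
  by apply/PsiP => N; rewrite big1// => k _; rewrite modulus0 powR0.
have modE L (F : pred nat) M k :
    modulus (\sum_(0 <= n < M | F n) c a n k * L%:R^-1) =
    modulus (\sum_(0 <= n < M | F n) c a n k) / L%:R.
  by rewrite -big_distrl /= modulusM modulusV -of_real_nat modulus_of_real
    normr_nat.
split=> -[L L0 h]; exists L => //; move: h;
  rewrite /= (sup_finite_sumsP (fun n k => c a n k * L%:R^-1) Psi0) => -[B hB];
  exists B => F M.
  move=> N; under eq_bigr do rewrite -modE.
  by move: N; apply/PsiP/hB.
apply/PsiP => N; under eq_bigr do rewrite modE.
exact: hB.
Qed.

(** The substitution x = T^-1 y. *)
Lemma alpha_dualP (X : set (nat -> K)) a : (forall n, r n != 0) ->
    (forall n, t n != 0) -> s 0%N != 0 -> u != 0 ->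
  alpha_dual (rstB_space X r s t u v) a <-> maps_to_ell1 (c a) X.
Proof.
move=> r0 t0 s0 u0; pose G := lt_transform (rstB_inv r s t u v).
have cG y : lt_transform (c a) y = (fun n => a n * G y n).
  by apply/funext => n; rewrite lt_transform_c_coef.
split=> [h y Xy|h x Xx].
  by rewrite cG; apply: h; rewrite /rstB_space /= rstB_invK.
by have := h _ Xx; rewrite cG /G rstBK.
Qed.

End Assembly.
Unset Implicit Arguments.

Theorem theorem4p4 (R : realType) (b : scalar_kind)
    (r s t : nat -> scalars R b) (u v : scalars R b) (p : nat -> R)
    (r_neq0 : forall n, r n != 0) (t_neq0 : forall n, t n != 0)
    (s0_neq0 : s 0%N != 0) (u_neq0 : u != 0) (v_neq0 : v != 0)
    (p_gt0 : forall k, 0 < p k) (p_bounded : has_ubound (range p)) :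
  ((forall k, 1 < p k) ->
     alpha_dual (rstB_space (maddox_l p) r s t u v) = H5 r s t u v p) /\
  ((forall k, p k <= 1) ->
     alpha_dual (rstB_space (maddox_l p) r s t u v) = H4 r s t u v p) /\
  alpha_dual (rstB_space (maddox_c0 p) r s t u v) = H1 r s t u v p /\
  alpha_dual (rstB_space (maddox_c p) r s t u v) =
    H1 r s t u v p `&` H2 r s t u v /\
  alpha_dual (rstB_space (maddox_linfty p) r s t u v) = H3 r s t u v p.
Proof.
have low a : lower_triangular (c_coef r s t u v a) by exact: c_coef_low.
split; [move=> p1|split; [move=> p1|split; [|split]]]; apply/predeqP => a;
  rewrite alpha_dualP//.
- by rewrite maps_l_gt1P// H5P.
- by rewrite maps_l_le1P// H4P.
- by rewrite maps_c0P// H1P.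
- rewrite maps_cP// maps_c0P//.
  by split=> -[h1 h2]; split; [apply/H1P|apply/H2P|apply/H1P|apply/H2P].
- by rewrite maps_linftyP// H3P.
Qed.
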